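(* Let $X$ be a locally convex Hausdorff space, $K\subset X$ a convex compact subset, $T:\mathscr{C}(K)\to\mathscr{C}(K)$ a Markov operator such that $T(h)=h$ for every $h\in A(K)$, $a\ge0$, and $(\mu_n)_{n\ge1}$ Borel probability measures on $K$. Suppose that ($c_1$) $T$ maps continuous convex functions into convex functions, and ($c_2$) $\Delta(f;x,y)\ge0$ for every convex $f\in\mathscr{C}(K)$ and every $x,y\in K$. Then each $C_n$ maps continuous convex functions into (continuous) convex functions.
   Context: $A(K)$ is the space of continuous affine functions on $K$. A Markov operator is a positive linear operator $T$ on $\mathscr{C}(K)$ with $T(\mathbf{1})=\mathbf{1}$; $(\tilde\mu_x^T)_{x\in K}$ are the Borel probability measures with $\int_Kf\,d\tilde\mu_x^T=T(f)(x)$. $C_n(f)(x)=\int_K\cdots\int_K f\big(\frac{x_1+\dots+x_n+a x_{n+1}}{n+a}\big)\,d\tilde\mu_x^T(x_1)\cdots d\tilde\mu_x^T(x_n)\,d\mu_n(x_{n+1})$. For $f\in\mathscr{C}(K)$ and $x,y\in K$, $$\Delta(f;x,y)=\iint_{K^2}f\big(\tfrac{s+t}{2}\big)d\tilde\mu_x^T(s)d\tilde\mu_x^T(t)+\iint_{K^2}f\big(\tfrac{s+t}{2}\big)d\tilde\mu_y^T(s)d\tilde\mu_y^T(t)-2\iint_{K^2}f\big(\tfrac{s+t}{2}\big)d\tilde\mu_x^T(s)d\tilde\mu_y^T(t).$$ *)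

(* Defs.v *)
From HB Require Import structures.
From mathcomp Require Import all_boot all_order all_algebra.
From mathcomp Require Import all_classical all_reals all_analysis.
Set Implicit Arguments. Unset Strict Implicit. Unset Printing Implicit Defensive.
Import Order.TTheory GRing.Theory Num.Theory numFieldNormedType.Exports.
Local Open Scope classical_set_scope.
Local Open Scope ring_scope.

Definition ptd (R : realType) (X : tvsType R) : Type := X.
HB.instance Definition _ (R : realType) (X : tvsType R) := Choice.on (@ptd R X).
HB.instance Definition _ (R : realType) (X : tvsType R) :=
  isPointed.Build (@ptd R X) 0%R.
Definition borel (R : realType) (X : tvsType R) :=
  g_sigma_algebraType (@open X : set (set (@ptd R X))).

Section defs.
Context (R : realType) (X : tvsType R).

Definition convex_subset (K : set X) : Prop :=
  forall x y (t : R), K x -> K y -> 0 <= t <= 1 -> K ((1 - t) *: x + t *: y).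

Definition convex_on (K : set X) (f : X -> R) : Prop :=
  forall x y (t : R), K x -> K y -> 0 <= t <= 1 ->
    f ((1 - t) *: x + t *: y) <= (1 - t) * f x + t * f y.

(** f is affine on K; A(K) = continuous functions on K that are affine. *)
Definition affine_on (K : set X) (f : X -> R) : Prop :=
  forall x y (t : R), K x -> K y -> 0 <= t <= 1 ->
    f ((1 - t) *: x + t *: y) = (1 - t) * f x + t * f y.

(** Elements of C(K) are represented by functions X -> R continuous on K;
    only their values on K matter. *)
Definition CK (K : set X) (f : X -> R) : Prop := {within K, continuous f}.

Definition markov_operator (K : set X) (T : (X -> R) -> (X -> R)) : Prop :=
  [/\ (* well defined on C(K): depends only on values on K *)
      (forall f g, CK K f -> CK K g -> {in K, f =1 g} -> {in K, T f =1 T g}),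
      (forall f, CK K f -> CK K (T f)),
      ((forall f g, CK K f -> CK K g -> {in K, T (f \+ g) =1 T f \+ T g}) /\
       (forall (c : R) f, CK K f -> {in K, T (fun x => c * f x) =1 (fun x => c * T f x)})),
      (forall f, CK K f -> (forall x, K x -> 0 <= f x) -> forall x, K x -> 0 <= T f x)
    &
      {in K, T (fun=> 1) =1 (fun=> 1)} ].

Fixpoint iter_Rint (nu : probability (@borel R X) R) (K : set X) (m : nat)
  (g : seq X -> R) : R :=
  match m with
  | 0 => g [::]
  | m'.+1 => Rintegral nu K (fun t : X => iter_Rint nu K m' (fun s => g (t :: s)))
  end.

Definition C_op (K : set X) (mu : X -> probability (@borel R X) R)
  (mun : nat -> probability (@borel R X) R) (a : R) (n : nat) (f : X -> R) (x : X) : R :=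
  Rintegral (mun n) K (fun z : X =>
    iter_Rint (mu x) K n
      (fun s => f ((n%:R + a)^-1 *: (\sum_(y <- s) y + a *: z)))).

Definition dbl_mid (K : set X) (nu1 nu2 : probability (@borel R X) R) (f : X -> R) : R :=
  Rintegral nu2 K (fun t : X => Rintegral nu1 K (fun s : X => f (2^-1 *: (s + t)))).

Definition Delta (K : set X) (mu : X -> probability (@borel R X) R) (f : X -> R) (x y : X) : R :=
  dbl_mid K (mu x) (mu x) f + dbl_mid K (mu y) (mu y) f - 2 * dbl_mid K (mu x) (mu y) f.

End defs.

(* Main.v *)
(* Let M_x be the operator (M_x g)(u) = int_K g(u + s) d(mu_x)(s). With
   g(v) = f(v / (n + a)), C_n(f)(x) is the integral of (M_x^n g)(a z) over mu_n(z), so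
   it suffices that x |-> (M_x^n g)(u) is convex for convex g. The M_x are positive,
   preserve convexity and commute (Fubini); c1 gives
   M_((1-t)x+ty) <= (1-t) M_x + t M_y and c2 gives (M_x - M_y)^2 >= 0 on convex
   functions. Hence (M_x - M_y)(M_x^n - M_y^n) = (M_x - M_y)^2 sum_i M_x^i M_y^(n-1-i)
   is nonnegative there, and induction on n yields
   M_((1-t)x+ty)^n <= (1-t) M_x^n + t M_y^n.
   Functions to be integrated m more times live on the dilates (b + m) K. *)
Require Import Defs.
From HB Require Import structures.
From mathcomp Require Import all_boot all_order all_algebra.
From mathcomp Require Import all_classical all_reals all_analysis.
From mathcomp Require Import ring lra.
Import Order.TTheory GRing.Theory Num.Theory.
Import numFieldNormedType.Exports.
Set Implicit Arguments. Unset Strict Implicit. Unset Printing Implicit Defensive.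
Local Open Scope classical_set_scope.
Local Open Scope ring_scope.

(** * Continuity on a subset in epsilon form, and arguments by compactness *)

Definition cont_on (R : realType) (P : topologicalType) (A : set P) (f : P -> R) :=
  forall x, A x -> forall e, 0 < e -> \forall y \near x, A y -> `|f y - f x| < e.

Lemma cont_onP (R : realType) (P : topologicalType) (A : set P) (f : P -> R) :
  {within A, continuous f} <-> cont_on A f.
Proof.
split.
  move=> /subspace_continuousP cf x Ax e e0.
  have /cvgrPdist_lt /(_ e e0) := cf x Ax.
  rewrite near_withinE.
  by apply: filterS => y h Ay; rewrite distrC; exact: h.
move=> cf; apply/subspace_continuousP => x Ax.
apply/cvgrPdist_lt => e e0; rewrite near_withinE.
by apply: filterS (cf x Ax e e0) => y h Ay; rewrite distrC; exact: h.
Qed.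

Lemma cont_on_comp (R : realType) (P Q : topologicalType) (A : set P) (B : set Q)
    (phi : P -> Q) (f : Q -> R) :
  continuous phi -> (forall p, A p -> B (phi p)) -> cont_on B f ->
  cont_on A (f \o phi).
Proof.
move=> cphi AB cf x Ax e e0.
have h : \forall y \near x, B (phi y) -> `|f (phi y) - f (phi x)| < e.
  exact: cphi x _ (cf _ (AB _ Ax) e e0).
by apply: filterS h => y /= h Ay; exact: h (AB _ Ay).
Qed.

Lemma cont_on_lin (R : realType) (P : topologicalType) (A : set P) (c d : R) (f g : P -> R) :
  cont_on A f -> cont_on A g -> cont_on A (fun p => c * f p + d * g p).
Proof.
move=> /cont_onP cf /cont_onP cg; apply/cont_onP => p.
by apply: cvgD; apply: cvgM; [exact: cst_continuous|exact: cf|exact: cst_continuous|exact: cg].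
Qed.

(** The sets [B] with [Q (K \ B)] form a filter containing [K], and it is proper if [Q K] fails. At
    a cluster point in [K], the neighbourhood [U] with [Q (K & U)] puts the complement of [U] in the
    filter, a contradiction. *)
Lemma compact_set_ind (P : topologicalType) (K : set P) (Q : set P -> Prop) :
  compact K -> Q set0 ->
  (forall A B, A `<=` B -> Q B -> Q A) ->
  (forall A B, Q A -> Q B -> Q (A `|` B)) ->
  (forall x, K x -> exists2 U, nbhs x U & Q (K `&` U)) -> Q K.
Proof.
move=> cK Q0 Qsub QU Qloc; apply: contrapT => nQ.
pose F : set_system P := fun B => Q (K `\` B).
have FF : ProperFilter F.
  apply: Build_ProperFilter_ex.
    move=> B FB; apply: contrapT => nB; apply: nQ.
    apply: Qsub FB => x Kx; split=> // Bx; apply: nB; by exists x.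
  split.
  - by rewrite /F setDT.
  - move=> A B; rewrite /F setDIr; exact: QU.
  - by move=> A B AB; rewrite /F; apply: Qsub; exact: setDS.
have FK : F K by rewrite /F setDv.
have [x [Kx clx]] := cK F FF FK.
have [U xU QKU] := Qloc x Kx.
have FU : F (~` U) by rewrite /F setDE setCK.
by have [y []] := clx _ _ FU xU.
Qed.

Lemma compact_bounded_on (R : realType) (P : topologicalType) (K : set P) (f : P -> R) :
  compact K -> cont_on K f -> exists M, forall x, K x -> `|f x| <= M.
Proof.
move=> cK cf.
apply: (@compact_set_ind _ K (fun A => exists M, forall x, A x -> `|f x| <= M)) => //.
- by exists 0 => x.
- by move=> A B AB [M h]; exists M => x /AB; exact: h.
- move=> A B [M h] [N g]; exists (Num.max M N) => x [/h|/g] hx;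
    by rewrite le_max hx ?orbT.
- move=> x Kx; eexists; first exact: (cf x Kx 1 ltr01).
  exists (`|f x| + 1) => y [Ky /(_ Ky) h].
  have := ler_normD (f y - f x) (f x); rewrite subrK; lra.
Qed.

(** Compact induction on the parts of [K] over which one neighbourhood of [p] works. *)
Lemma tube_lemma (R : realType) (P Q : topologicalType) (A : set P) (K : set Q)
    (H : P * Q -> R) (p : P) (e : R) :
  compact K -> cont_on (A `*` K) H -> A p -> 0 < e ->
  \forall q \near p, A q -> forall s, K s -> `|H (q, s) - H (p, s)| < e.
Proof.
move=> cK cH Ap e0.
apply: (@compact_set_ind _ K (fun B => \forall q \near p, A q -> forall s, B s ->
   `|H (q, s) - H (p, s)| < e)) => //.
- by apply: nearW.
- by move=> B C BC; apply: filterS => q h Aq s /BC; exact: h.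
- move=> B C; apply: filterS2 => q hB hC Aq s [Bs|Cs]; [exact: hB|exact: hC].
- move=> s Ks; have e20 : 0 < e / 2 by lra.
  have [[V U] /= [Vp Us] VU] := cH (p, s) (conj Ap Ks) _ e20.
  exists U => //; apply: filterS (Vp) => q Vq Aq t [Kt Ut].
  (* Both [(q, t)] and [(p, t)] lie in the box where [H] is within e/2 of [H (p, s)]. *)
  have h1 := VU (q, t) (conj Vq Ut) (conj Aq Kt).
  have h2 := VU (p, t) (conj (nbhs_singleton Vp) Ut) (conj Ap Kt).
  by have := ler_distD (H (p, s)) (H (q, t)) (H (p, t)); rewrite (distrC (H (p, s))); lra.
Qed.

(** * Integrals over K of continuous functions against Borel probabilities, and Fubini *)

Section borel_integral.
Context (R : realType) (X : tvsType R) (K : set X).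
Hypotheses (hX : hausdorff_space X) (cK : compact K).

Lemma measurable_borel_open (U : set X) : open U -> measurable (U : set (@borel R X)).
Proof. by move=> oU; apply: sub_sigma_algebra. Qed.

Lemma measurable_compact : measurable (K : set (@borel R X)).
Proof.
rewrite -(setCK K); apply: (@measurableC _ (@borel R X)); apply: measurable_borel_open.
by rewrite openC; exact: compact_closed.
Qed.

Lemma cont_on_measurable (f : X -> R) : cont_on K f ->
  measurable_fun (K : set (@borel R X)) (f : @borel R X -> R).
Proof.
move=> cf mK; apply: (measurability _ (measurable_realfun.RGenOInfty.measurableE R)) => //.
move=> _ [_ [c ->] <-].
(* The superlevel set is relatively open in [K]; this interior is an open set of [X] with the same
   trace. *)
have -> : K `&` f @^-1` `]c, +oo[ = K `&` ([set y | K y -> c < f y])°.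
  apply/seteqP; split=> x [Kx].
    rewrite /= in_itv/= andbT => fx; split=> //.
    have e0 : 0 < f x - c by lra.
    apply: filterS (cf x Kx _ e0) => y h /h; rewrite ltr_distl; lra.
  move=> /interior_subset /(_ Kx) fx; split=> //.
  by rewrite /= in_itv/= andbT.
apply: (@measurableI _ (@borel R X)); first exact: measurable_compact.
by apply: measurable_borel_open; exact: open_interior.
Qed.

Lemma cont_on_integrable (nu : probability (@borel R X) R) (f : X -> R) :
  cont_on K f -> nu.-integrable K (EFin \o f).
Proof.
move=> cf; apply: measurable_bounded_integrable.
- exact: measurable_compact.
- by rewrite (le_lt_trans (probability_le1 _ _)) ?ltry//; exact: measurable_compact.
- exact: cont_on_measurable.
- have [M hM] := compact_bounded_on cK cf.
  exists M; split; first exact: num_real.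
  by move=> N MN x Kx; rewrite /= (le_trans (hM _ Kx))// ltW.
Qed.

Lemma Rintegral_dist_le (nu : probability (@borel R X) R) (f g : X -> R) (e : R) :
  nu K = 1%E -> cont_on K f -> cont_on K g ->
  (forall s, K s -> `|f s - g s| <= e) ->
  `|Rintegral nu K f - Rintegral nu K g| <= e.
Proof.
move=> nu1 cf cg fg.
have mK := measurable_compact.
have Rcst c : Rintegral nu K (cst c) = c.
  rewrite Rintegral_cst// -[RHS]mulr1; congr (_ * _); exact: (congr1 fine nu1).
have icst c : nu.-integrable K (EFin \o cst c).
  by apply: cont_on_integrable => x Kx d d0; apply: nearW => y _; rewrite subrr normr0.
have if_ := cont_on_integrable nu cf; have ig := cont_on_integrable nu cg.
have ifg : nu.-integrable K (EFin \o (fun x => f x - g x)).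
  by apply: (eq_integrable mK _ _ _ (integrableB mK if_ ig)) => x _.
rewrite -RintegralB// ler_norml; apply/andP; split.
  rewrite -[leLHS]Rcst; apply: (le_Rintegral mK (icst _) ifg) => x Kx.
  by have := fg x Kx; rewrite ler_norml => /andP[].
rewrite -[leRHS]Rcst; apply: (le_Rintegral mK ifg (icst _)) => x Kx.
by have := fg x Kx; rewrite ler_norml => /andP[].
Qed.

Lemma Rintegral_lin (nu : probability (@borel R X) R) (c d : R) (f g : X -> R) :
  cont_on K f -> cont_on K g ->
  Rintegral nu K (fun s => c * f s + d * g s) = c * Rintegral nu K f + d * Rintegral nu K g.
Proof.
move=> cf cg; have mK := measurable_compact.
have if_ := cont_on_integrable nu cf; have ig := cont_on_integrable nu cg.
have iZ (e : R) k : nu.-integrable K (EFin \o k) ->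
    nu.-integrable K (EFin \o (fun s => e * k s)).
  by move=> ik; apply: (eq_integrable mK _ _ _ (integrableZl mK e ik)) => s _.
by rewrite RintegralD ?RintegralZl//; exact: iZ.
Qed.

Lemma le_Rintegral_lin (nu : probability (@borel R X) R) (c d c' d' : R)
    (f g f' g' : X -> R) :
  cont_on K f -> cont_on K g -> cont_on K f' -> cont_on K g' ->
  (forall s, K s -> c * f s + d * g s <= c' * f' s + d' * g' s) ->
  c * Rintegral nu K f + d * Rintegral nu K g <=
  c' * Rintegral nu K f' + d' * Rintegral nu K g'.
Proof.
move=> cf cg cf' cg' le; rewrite -!Rintegral_lin//.
by apply: le_Rintegral => //; [exact: measurable_compact|
  exact/cont_on_integrable/cont_on_lin|exact/cont_on_integrable/cont_on_lin].
Qed.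

Lemma Rintegral_le_comb (nu : probability (@borel R X) R) (c d : R) (f g h : X -> R) :
  cont_on K f -> cont_on K g -> cont_on K h ->
  (forall s, K s -> h s <= c * f s + d * g s) ->
  Rintegral nu K h <= c * Rintegral nu K f + d * Rintegral nu K g.
Proof.
move=> cf cg ch le.
have := @le_Rintegral_lin nu 1 0 c d h h f g ch ch cf cg; rewrite mul1r mul0r addr0; apply.
by move=> s Ks; rewrite mul1r mul0r addr0; exact: le.
Qed.

(* The Borel sets of K x K may exceed the product of the Borel sets of K, but a
   continuous function is product-measurable: its superlevel sets are
   approximated by finite unions of open rectangles. *)
Lemma cont_on_setX_measurable (G : X * X -> R) : cont_on (K `*` K) G ->
  measurable_fun ((K `*` K) : set (@borel R X * @borel R X)) (G : @borel R X * @borel R X -> R).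
Proof.
move=> cG mKK; apply: (measurability _ (measurable_realfun.RGenOInfty.measurableE R)) => //.
move=> _ [_ [c ->] <-].
have cKK : compact (K `*` K) by exact: compact_setX.
have W (n : nat) : exists W : set (@borel R X * @borel R X), [/\ measurable W,
    forall q, (K `*` K) q -> c + n.+1%:R^-1 < G q -> W q &
    forall q, (K `*` K) q -> W q -> c < G q].
  have e0 : 0 < (n.+1%:R^-1 : R) by rewrite invr_gt0.
  set e := (n.+1%:R^-1 : R) in e0 *.
  apply: (@compact_set_ind (X * X)%type (K `*` K) (fun A =>
    exists W : set (@borel R X * @borel R X), [/\ measurable W,
    forall q, A q -> c + e < G q -> W q &
    forall q, (K `*` K) q -> W q -> c < G q])) => //.
  - by exists set0; split.
  - by move=> A B AB [V [mV h1 h2]]; exists V; split=> // q /AB; exact: h1.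
  - move=> A B [V [mV h1 h2]] [V' [mV' h1' h2']]; exists (V `|` V'); split.
    + exact: measurableU.
    + by move=> q [/h1 h /h|/h1' h /h]; [left|right].
    + by move=> q Kq [/h2|/h2']; exact.
  - move=> p Kp; have e20 : 0 < e / 2 by lra.
    have [[V U] /= [Vp Up] VU] := cG p Kp _ e20.
    have close q : (K `*` K) q -> (V° `*` U°) q -> `|G q - G p| < e / 2.
      by move=> Kq [/interior_subset Vq /interior_subset Uq]; exact: VU.
    exists (V° `*` U°).
      by exists (V°, U°) => //; split; apply: nbhs_interior.
    (* In the first case [G] stays below c + e on the box, so the empty set serves; in the second
       [G] exceeds c on the whole box. *)
    have [Gp|Gp] := leP (G p) (c + e / 2).
      exists set0; split=> // q [Kq VUq].
      by have := close q Kq VUq; rewrite ltr_distl; lra.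
    exists (V° `*` U°); split.
    + by apply: measurableX; apply: measurable_borel_open; exact: open_interior.
    + by move=> q [].
    + by move=> q Kq VUq; have := close q Kq VUq; rewrite ltr_distl; lra.
have [V hV] := choice W.
have -> : (K `*` K) `&` G @^-1` `]c, +oo[ = (K `*` K) `&` \bigcup_n V n.
  apply/seteqP; split=> q [Kq].
    rewrite /= in_itv/= andbT => Gq; split=> //.
    have [n hn] : exists n, n.+1%:R^-1 < G q - c.
      have Gc : 0 < G q - c by lra.
      exact: (filter_ex (near_infty_natSinv_lt (PosNum Gc))).
    by exists n => //; have [_ h _] := hV n; apply: h => //; rewrite -ltrBrDl.
  by move=> [n _ Vq]; have [_ _ h] := hV n; split=> //; rewrite /= in_itv/= andbT; exact: h.
apply: measurableI => //; apply: bigcupT_measurable => n.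
by have [] := hV n.
Qed.

Lemma cont_on_section (P Q : topologicalType) (A : set P) (B : set Q) (G : P * Q -> R) p :
  cont_on (A `*` B) G -> A p -> cont_on B (fun q => G (p, q)).
Proof.
move=> cG Ap; apply: (cont_on_comp (phi := fun q => (p, q)) _ _ cG) => // q.
by apply: cvg_pair; [exact: cvg_cst|exact: cvg_id].
Qed.

Lemma cont_on_swap (P Q : topologicalType) (A : set P) (B : set Q) (G : P * Q -> R) :
  cont_on (A `*` B) G -> cont_on (B `*` A) (fun q => G (q.2, q.1)).
Proof.
move=> cG; apply: (cont_on_comp (phi := fun q => (q.2, q.1)) _ _ cG) => [|? []//] q.
by apply: cvg_pair; [exact: cvg_snd|exact: cvg_fst].
Qed.

(** Extending [G] by zero off K x K turns the iterated real integral into one over the whole space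
    with extended real values, the form in which Fubini applies. *)
Lemma Rintegral_iterated (nu1 nu2 : probability (@borel R X) R) (G : X * X -> R) :
  cont_on (K `*` K) G ->
  Rintegral nu1 K (fun s => Rintegral nu2 K (fun t => G (s, t))) =
  fine (\int[nu1]_s \int[nu2]_t ((G \_ (K `*` K)) (s, t))%:E)%E.
Proof.
move=> cG; have mK := measurable_compact.
rewrite /Rintegral; congr fine; rewrite [LHS]integral_mkcond.
apply: eq_integral => s _; rewrite patchE; case: ifPn => [/set_mem Ks|sK].
  rewrite fineK; last first.
    apply: integrable_fin_num => //; apply: cont_on_integrable.
    exact: cont_on_section cG Ks.
  rewrite integral_mkcond; apply: eq_integral => t _.
  rewrite !patchE in_setX (mem_set Ks) /=.
  by case: ifP.
rewrite integral0_eq// => t _.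
by rewrite patchE in_setX (negbTE sK).
Qed.

(** The extension by zero is bounded and measurable for the product sigma-algebra, hence integrable
    for the product of two probabilities. *)
Lemma Rintegral_exchange (nu1 nu2 : probability (@borel R X) R) (G : X * X -> R) :
  cont_on (K `*` K) G ->
  Rintegral nu1 K (fun s => Rintegral nu2 K (fun t => G (s, t))) =
  Rintegral nu2 K (fun t => Rintegral nu1 K (fun s => G (s, t))).
Proof.
move=> cG.
have mKK : measurable ((K `*` K) : set (@borel R X * @borel R X)).
  by apply: measurableX; exact: measurable_compact.
pose F : @borel R X * @borel R X -> R := G \_ (K `*` K).
have mF : measurable_fun setT F.
  by apply: (measurable_restrictT _ mKK).1; exact: cont_on_setX_measurable.
have iF : (nu1 \x nu2)%E.-integrable setT (EFin \o F).
  apply: measurable_bounded_integrable => //.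
    apply: le_lt_trans (ltry (1 : R)).
    rewrite /= -setXTT product_measure1E// -[leRHS]mule1.
    by apply: lee_pmul => //; exact: probability_le1.
  have [M hM] := compact_bounded_on (compact_setX cK cK) cG.
  (* The bound must also cover the value 0 off K x K, and [M] may be negative when [K] is empty. *)
  exists `|M|; split; first exact: num_real.
  move=> N MN q _; rewrite /= /F patchE; case: ifPn => [/set_mem Kq|_].
    by rewrite (le_trans (hM _ Kq))// ltW// (le_lt_trans _ MN)// ler_norm.
  by rewrite normr0 ltW// (le_lt_trans _ MN).
rewrite Rintegral_iterated// (Rintegral_iterated nu2 nu1 (cont_on_swap cG)).
congr fine; rewrite (Fubini iF); apply: eq_integral => t _; apply: eq_integral => s _.
by rewrite /= /F !patchE !in_setX andbC.
Qed.
End borel_integral.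

(** * Continuity of the vector operations *)

Lemma continuous_pair (P Q S : topologicalType) (f : P -> Q) (g : P -> S) :
  continuous f -> continuous g -> continuous (fun p => (f p, g p)).
Proof. by move=> cf cg p; apply: cvg_pair; [exact: cf|exact: cg]. Qed.

Lemma tvs_addf_continuous (R : realType) (X : tvsType R) (P : topologicalType)
    (f g : P -> X) :
  continuous f -> continuous g -> continuous (fun p => f p + g p).
Proof.
move=> cf cg p.
apply: (@cvg_comp _ _ _ (fun p => (f p, g p)) (fun q : X * X => q.1 + q.2)).
  exact: continuous_pair.
exact: (@add_continuous X (f p, g p)).
Qed.

Lemma dilation_continuous (R : realType) (X : tvsType R) (c : R) :
  continuous (fun s : X => c *: s).
Proof.
move=> s.
apply: (@cvg_comp _ _ _ (fun s : X => (c : R^o, s)) (fun q : R^o * X => q.1 *: q.2)).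
  by apply: (@continuous_pair X R^o X (fun=> c) id) => ?; [exact: cst_continuous|exact: cvg_id].
exact: (@scale_continuous R X (c, s)).
Qed.

Lemma shift_continuous (R : realType) (X : tvsType R) (u : X) :
  continuous (fun s : X => u + s).
Proof. by apply: tvs_addf_continuous => s; [exact: cst_continuous|exact: cvg_id]. Qed.

(** * Dilates of a convex set *)

Section dilates.
Context (R : realType) (X : tvsType R) (K : set X).
Hypothesis convK : convex_subset K.

Definition dilate (b : R) : set X := [set b *: k | k in K].

Lemma dilate_add (b c : R) (u k : X) : 0 <= b -> 0 < c -> dilate b u -> K k ->
  dilate (b + c) (u + c *: k).
Proof.
move=> b0 c0 [k0 Kk0 <-] Kk.
have bc0 : b + c != 0 by rewrite gt_eqF//; lra.
(* Weights b/(b+c) and c/(b+c). Positivity of [c] keeps b + c nonzero while allowing b = 0, which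
   occurs when a = 0. *)
exists ((1 - c / (b + c)) *: k0 + (c / (b + c)) *: k).
  apply: convK => //; apply/andP; split; [rewrite divr_ge0|rewrite ler_pdivrMr]; lra.
rewrite scalerDr !scalerA; congr (_ *: _ + _ *: _); by field.
Qed.

Lemma dilateS (b : R) (u k : X) : 0 <= b -> dilate b u -> K k -> dilate (b + 1) (u + k).
Proof. by move=> b0 bu Kk; rewrite -[k]scale1r; exact: dilate_add. Qed.

Lemma convex_dilate (b : R) : convex_subset (dilate b).
Proof.
move=> _ _ t [k Kk <-] [k' Kk' <-] t01.
exists ((1 - t) *: k + t *: k'); first exact: convK.
by rewrite scalerDr !scalerA; congr (_ *: _ + _ *: _); ring.
Qed.
End dilates.

(** * The operators M_x and their joint continuity in x and u *)

Section markov.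
Context (R : realType) (X : tvsType R) (K : set X) (mu : X -> probability (@borel R X) R).
Context (T : (X -> R) -> (X -> R)).
Hypotheses (hX : hausdorff_space X) (cK : compact K) (convK : convex_subset K).
Hypothesis mu1 : forall x, K x -> mu x K = 1%E.
Hypothesis T_CK : forall f, CK K f -> CK K (T f).
Hypothesis mu_T : forall x f, K x -> CK K f ->
  (\int[mu x]_(t in K) (f t)%:E)%E = (T f x)%:E.

(** From (q, y) to (p, x) in two moves. Replacing q by p under [mu y] costs at most e/2, uniformly
    in y, by the tube lemma. Replacing y by x at fixed p costs less than e/2, since the integral is
    then a value of [T], which preserves C(K). *)
Lemma cont_on_Rintegral (P : topologicalType) (A : set P) (H : P * X -> R) :
  cont_on (A `*` K) H ->
  cont_on (A `*` K) (fun q => Rintegral (mu q.2) K (fun s => H (q.1, s))).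
Proof.
move=> cH [p x] [/= Ap Kx] e e0; have e20 : 0 < e / 2 by lra.
have cHp q : A q -> cont_on K (fun s => H (q, s)) by move=> Aq; exact: cont_on_section cH Aq.
have IT y : K y -> Rintegral (mu y) K (fun s => H (p, s)) = T (fun s => H (p, s)) y.
  by move=> Ky; rewrite /Rintegral mu_T//; exact/cont_onP/cHp.
have /cont_onP cT := T_CK ((cont_onP _ _).2 (cHp p Ap)).
have nx := cT x Kx _ e20; have np := tube_lemma cK cH Ap e20.
exists ([set q | A q -> forall s, K s -> `|H (q, s) - H (p, s)| < e / 2],
  [set y | K y -> `|T (fun s => H (p, s)) y - T (fun s => H (p, s)) x| < e / 2]) => //.
move=> [q y] [/= hq hy] [/= Aq Ky].
have := hy Ky; rewrite -!IT// => h1.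
have h2 : `|Rintegral (mu y) K (fun s => H (q, s)) -
            Rintegral (mu y) K (fun s => H (p, s))| <= e / 2.
  apply: (Rintegral_dist_le hX cK); [exact: mu1|exact: cHp|exact: cHp|].
  by move=> s Ks; exact/ltW/hq.
apply: le_lt_trans (ler_distD (Rintegral (mu y) K (fun s => H (p, s))) _ _) _; lra.
Qed.

Lemma cont_on_Rintegral_param (P : topologicalType) (A : set P) (H : P * X -> R)
    (nu : probability (@borel R X) R) :
  nu K = 1%E -> cont_on (A `*` K) H ->
  cont_on A (fun p => Rintegral nu K (fun s => H (p, s))).
Proof.
move=> nu1 cH p Ap e e0; have e20 : 0 < e / 2 by lra.
apply: filterS (tube_lemma cK cH Ap e20) => q hq Aq.
(* Integrating a strict bound yields only a weak one, hence the margin e/2. *)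
apply: (@le_lt_trans _ _ (e / 2)); last lra.
apply: (Rintegral_dist_le hX cK) => //;
  [exact: cont_on_section cH Aq|exact: cont_on_section cH Ap|].
by move=> s Ks; exact/ltW/hq.
Qed.

(** The operator M_x, that is, convolution with the reflection of [mu x]. As the integral is over
    [K], only the values of [g] on u + K matter. *)
Definition conv_op (x : X) (g : X -> R) (u : X) : R :=
  Rintegral (mu x) K (fun s => g (u + s)).

(** Each integration variable is absorbed into the base point, so the induction keeps [u]
    general. *)
Lemma iter_conv_op (x : X) (g : X -> R) n u :
  iter_Rint (mu x) K n (fun s => g (u + \sum_(y <- s) y)) = iter n (conv_op x) g u.
Proof.
elim: n u => [|n IH] u; first by rewrite /= big_nil addr0.
rewrite iterS /conv_op /=; congr (Rintegral _ _ _); apply/funext => t.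
rewrite -IH; congr iter_Rint; apply/funext => s.
by rewrite big_cons addrA.
Qed.

Notation D := (dilate K).

Lemma cont_on_shift (b : R) (u : X) (g : X -> R) : 0 <= b -> D b u -> cont_on (D (b + 1)) g ->
  cont_on K (fun s => g (u + s)).
Proof.
move=> b0 bu; apply: cont_on_comp; first exact: shift_continuous.
by move=> s Ks; exact: dilateS.
Qed.

(** [F] may depend on x because an iterate is applied to a function already built from M_x.
    Continuity is first shown with the x in [F] and the x of the measure independent, then
    restricted to the diagonal. *)
Lemma conv_op_cont2 (b : R) (F : X -> X -> R) : 0 <= b ->
  cont_on (K `*` D (b + 1)) (fun q => F q.1 q.2) ->
  cont_on (K `*` D b) (fun q => conv_op q.1 (F q.1) q.2).
Proof.
move=> b0 cF.
have cH : cont_on ((K `*` D b) `*` K) (fun q => F q.1.1 (q.1.2 + q.2)).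
  apply: (cont_on_comp (phi := fun q : (X * X) * X => (q.1.1, q.1.2 + q.2)) _ _ cF).
    apply: continuous_pair => [q|].
      by apply: (cvg_comp _ _ (@cvg_fst _ _ _ _ _)); exact: cvg_fst.
    apply: tvs_addf_continuous => q; last exact: cvg_snd.
    by apply: (cvg_comp _ _ (@cvg_fst _ _ _ _ _)); exact: cvg_snd.
  by move=> [[x u] s] [[/= Kx bu] Ks]; split=> //=; exact: dilateS.
apply: (cont_on_comp (phi := fun q : X * X => (q, q.1)) _ _ (cont_on_Rintegral cH)).
  by apply: continuous_pair => q; [exact: cvg_id|exact: cvg_fst].
by move=> [x u] [].
Qed.

Lemma iter_conv_op_cont2 n (b : R) (g : X -> R) : 0 <= b -> cont_on (D (b + n%:R)) g ->
  cont_on (K `*` D b) (fun q => iter n (conv_op q.1) g q.2).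
Proof.
elim: n b => [|n IH] b b0 cg.
  apply: (cont_on_comp (phi := snd) (B := D b)).
  - by move=> q; exact: cvg_snd.
  - by move=> q [].
  - by rewrite addr0 in cg.
under eq_fun do rewrite iterS.
apply: (conv_op_cont2 (F := fun x => iter n (conv_op x) g)) => //.
apply: IH; first lra.
by rewrite -addrA nat1r.
Qed.

Lemma conv_op_cont x (b : R) (g : X -> R) : 0 <= b -> K x -> cont_on (D (b + 1)) g ->
  cont_on (D b) (conv_op x g).
Proof.
move=> b0 Kx cg.
have := @iter_conv_op_cont2 1 b g b0 cg.
by move=> /cont_on_section /(_ Kx).
Qed.

(** * Positivity, commutation and preservation of convexity *)

Lemma conv_op_le_lin x (b c d c' d' : R) (g h g' h' : X -> R) u : 0 <= b -> D b u ->
  cont_on (D (b + 1)) g -> cont_on (D (b + 1)) h ->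
  cont_on (D (b + 1)) g' -> cont_on (D (b + 1)) h' ->
  (forall v, D (b + 1) v -> c * g v + d * h v <= c' * g' v + d' * h' v) ->
  c * conv_op x g u + d * conv_op x h u <= c' * conv_op x g' u + d' * conv_op x h' u.
Proof.
move=> b0 bu cg ch cg' ch' le.
apply: (le_Rintegral_lin hX cK); [exact: cont_on_shift bu cg|exact: cont_on_shift bu ch|
  exact: cont_on_shift bu cg'|exact: cont_on_shift bu ch'|].
by move=> s Ks; apply: le; exact: dilateS.
Qed.

(** Both sides integrate g(u + s + t) over K x K; the two shifts account for the dilate b + 1 +
    1. *)
Lemma conv_opC x y (b : R) (g : X -> R) u : 0 <= b -> D b u -> K x -> K y ->
  cont_on (D (b + 1 + 1)) g ->
  conv_op x (conv_op y g) u = conv_op y (conv_op x g) u.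
Proof.
move=> b0 bu Kx Ky cg.
have cG : cont_on (K `*` K) (fun q => g (u + q.1 + q.2)).
  apply: (cont_on_comp (phi := fun q : X * X => u + q.1 + q.2) _ _ cg).
    apply: tvs_addf_continuous => r; last exact: cvg_snd.
    by apply: tvs_addf_continuous => ?; [exact: cst_continuous|exact: cvg_fst].
  move=> [s t] [/= Ks Kt]; apply: dilateS => //; [lra|exact: dilateS].
rewrite /conv_op (Rintegral_exchange hX cK (mu x) (mu y) cG).
by under eq_Rintegral do under eq_Rintegral do rewrite addrAC.
Qed.

Definition cvx_cont (b : R) (g : X -> R) := cont_on (D b) g /\ convex_on (D b) g.

Lemma convex_shift (b : R) u (g : X -> R) : 0 <= b -> D b u ->
  convex_on (D (b + 1)) g -> convex_on K (fun s => g (u + s)).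
Proof.
move=> b0 bu vg s s' t Ks Ks' t01.
have -> : u + ((1 - t) *: s + t *: s') = (1 - t) *: (u + s) + t *: (u + s').
  by rewrite !scalerDr addrACA -scalerDl subrK scale1r.
by apply: vg => //; exact: dilateS.
Qed.

Lemma conv_op_cvx x (b : R) g : 0 <= b -> K x -> cvx_cont (b + 1) g ->
  cvx_cont b (conv_op x g).
Proof.
move=> b0 Kx [cg vg]; split; first exact: conv_op_cont.
move=> u v t bu bv t01.
have bw := convex_dilate convK bu bv t01.
apply: (Rintegral_le_comb hX cK); [exact: cont_on_shift bu cg|exact: cont_on_shift bv cg|
  exact: cont_on_shift bw cg|].
move=> s Ks.
have -> : (1 - t) *: u + t *: v + s = (1 - t) *: (u + s) + t *: (v + s).
  by rewrite !scalerDr addrACA -scalerDl subrK scale1r.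
by apply: vg => //; exact: dilateS.
Qed.

Lemma iter_conv_op_cvx n x (b : R) g : 0 <= b -> K x -> cvx_cont (b + n%:R) g ->
  cvx_cont b (iter n (conv_op x) g).
Proof.
move=> b0 Kx; elim: n b b0 => [|n IH] b b0; first by rewrite addr0.
move=> bg; rewrite iterS; apply: conv_op_cvx => //; apply: IH; first lra.
by rewrite -addrA nat1r.
Qed.

(** * Inequalities drawn from (c1) and (c2) *)

Hypothesis T_convex : forall f, CK K f -> convex_on K f -> convex_on K (T f).
Hypothesis Delta_ge0 : forall f, CK K f -> convex_on K f ->
  forall x y, K x -> K y -> 0 <= Delta K mu f x y.

(** For fixed u, M_z g(u) is the value at z of [T] applied to the convex function s |-> g(u + s), so
    (c1) applies. *)
Lemma conv_op_convex_measure x y t (b : R) g u : 0 <= b -> D b u -> K x -> K y ->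
  0 <= t <= 1 -> cvx_cont (b + 1) g ->
  conv_op ((1 - t) *: x + t *: y) g u <= (1 - t) * conv_op x g u + t * conv_op y g u.
Proof.
move=> b0 bu Kx Ky t01 [cg vg].
have cu : CK K (fun s => g (u + s)) by apply/cont_onP; exact: cont_on_shift bu cg.
have IT z : K z -> conv_op z g u = T (fun s => g (u + s)) z.
  by move=> Kz; rewrite /conv_op /Rintegral mu_T.
rewrite !IT//; last exact: convK.
by apply: T_convex => //; exact: convex_shift bu vg.
Qed.

Lemma conv_op_diff2_ge0 x y (b : R) g u : 0 <= b -> D b u -> K x -> K y ->
  cvx_cont (b + 1 + 1) g ->
  0 <= conv_op x (conv_op x g) u + conv_op y (conv_op y g) u
       - 2 * conv_op x (conv_op y g) u.
Proof.
move=> b0 bu Kx Ky [cg vg].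
have b2 : b + 1 + 1 = b + 2 by ring.
rewrite b2 in cg vg.
(* The factor 2 cancels the midpoint: f((s + t)/2) = g(u + s + t). Moreover u + 2k lies in the
   dilate b + 2. *)
pose f k := g (u + (2 : R) *: k).
have mid z w : conv_op z (conv_op w g) u = dbl_mid K (mu w) (mu z) f.
  rewrite /conv_op /dbl_mid /f; congr Rintegral; apply/funext => t.
  congr Rintegral; apply/funext => s.
  by rewrite scalerA divff// scale1r (addrC s) addrA.
have cf : CK K f.
  apply/cont_onP; apply: (cont_on_comp (phi := fun k => u + (2 : R) *: k) _ _ cg).
    apply: tvs_addf_continuous; first by move=> ?; exact: cst_continuous.
    exact: dilation_continuous.
  by move=> k Kk; exact: dilate_add.
have vf : convex_on K f.
  move=> k k' t Kk Kk' t01; rewrite /f.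
  have -> : u + (2 : R) *: ((1 - t) *: k + t *: k') =
      (1 - t) *: (u + (2 : R) *: k) + t *: (u + (2 : R) *: k').
    rewrite !scalerDr addrACA -scalerDl subrK scale1r.
    by rewrite !scalerA (mulrC 2) (mulrC 2).
  by apply: vg => //; exact: dilate_add.
(* Taking y before x makes the cross term of [Delta] equal to M_x M_y g(u), in the order of the
   goal. *)
have := Delta_ge0 cf vf Ky Kx; rewrite /Delta !mid.
lra.
Qed.

(* Writing x, y for the commuting operators conv_op x, conv_op y, this says that
   (x - y)(x^n - y^n) >= 0 on convex functions; induction rests on
   (x - y)(x^(n+1) - y^(n+1)) = (x - y)^2 x^n + y (x - y)(x^n - y^n). *)
Lemma conv_op_diff_iter_ge0 n x y (b : R) g u : 0 <= b -> D b u -> K x -> K y ->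
  cvx_cont (b + n.+1%:R) g ->
  conv_op x (iter n (conv_op y) g) u + conv_op y (iter n (conv_op x) g) u <=
  conv_op x (iter n (conv_op x) g) u + conv_op y (iter n (conv_op y) g) u.
Proof.
move=> b0 + Kx Ky; elim: n b b0 u => [|n IH] b b0 u bu bg; first by rewrite addrC.
have b10 : 0 <= b + 1 by lra.
have b110 : 0 <= b + 1 + 1 by lra.
have En : b + n.+2%:R = b + 1 + 1 + n%:R by rewrite !mulrS; ring.
rewrite En in bg.
have vp := iter_conv_op_cvx b110 Kx bg; have vq := iter_conv_op_cvx b110 Ky bg.
set p := iter n _ g in vp; set q := iter n _ g in vq.
have [cp _] := vp; have [cq _] := vq.
rewrite 2!iterS -/p -/q.
have h1 := conv_op_diff2_ge0 b0 bu Kx Ky vp.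
have cxp := conv_op_cont b10 Kx cp; have cyp := conv_op_cont b10 Ky cp.
have cxq := conv_op_cont b10 Kx cq; have cyq := conv_op_cont b10 Ky cq.
(* The induction hypothesis one dilate higher, with unit coefficients so that M_y can be applied
   through [conv_op_le_lin]. *)
have step v : D (b + 1) v -> 1 * conv_op x q v + 1 * conv_op y p v <=
    1 * conv_op x p v + 1 * conv_op y q v.
  move=> bv; rewrite !mul1r; apply: (IH (b + 1)) => //.
  by rewrite -nat1r addrA.
have h2 := conv_op_le_lin y b0 bu cxq cyp cxp cyq step.
have h3 := conv_opC b0 bu Kx Ky cp; have h4 := conv_opC b0 bu Kx Ky cq.
(* With the values made atoms, the identity above becomes linear arithmetic, [h3] and [h4] matching
   the mixed terms. *)
move: h1 h2 h3 h4; generalize (conv_op x (conv_op x p) u) (conv_op x (conv_op y p) u)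
  (conv_op y (conv_op x p) u) (conv_op y (conv_op y p) u)
  (conv_op x (conv_op y q) u) (conv_op y (conv_op x q) u) (conv_op y (conv_op y q) u).
by move=> *; lra.
Qed.

(** Put p = M_x^n g and q = M_y^n g. By induction and positivity M_z^(n+1) g <= (1-t) M_z p + t M_z
    q; then M_z <= (1-t) M_x + t M_y on p and q. The target (1-t) M_x p + t M_y q exceeds the
    resulting bound by t(1-t)(M_x p + M_y q - M_x q - M_y p), nonnegative by
    [conv_op_diff_iter_ge0]. *)
Lemma iter_conv_op_convex_measure n x y t (b : R) g u : 0 <= b -> D b u -> K x -> K y ->
  0 <= t <= 1 -> cvx_cont (b + n%:R) g ->
  iter n (conv_op ((1 - t) *: x + t *: y)) g u <=
  (1 - t) * iter n (conv_op x) g u + t * iter n (conv_op y) g u.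
Proof.
move=> b0 + Kx Ky t01; elim: n b b0 u => [|n IH] b b0 u bu bg.
  by rewrite /= -mulrDl subrK mul1r.
have Kz := convK Kx Ky t01; set z := (1 - t) *: x + t *: y in Kz *.
have b10 : 0 <= b + 1 by lra.
have h := conv_op_diff_iter_ge0 b0 bu Kx Ky bg.
rewrite -nat1r addrA in bg.
have vz := iter_conv_op_cvx b10 Kz bg.
have vp := iter_conv_op_cvx b10 Kx bg; have vq := iter_conv_op_cvx b10 Ky bg.
have hp := conv_op_convex_measure b0 bu Kx Ky t01 vp.
have hq := conv_op_convex_measure b0 bu Kx Ky t01 vq.
rewrite -/z in hp hq.
have [cz _] := vz; have [cp _] := vp; have [cq _] := vq.
(* The term with coefficient 0 only fills the fourth slot of [conv_op_le_lin]. *)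
have step v : D (b + 1) v -> 1 * iter n (conv_op z) g v +
      0 * iter n (conv_op x) g v <=
    (1 - t) * iter n (conv_op x) g v + t * iter n (conv_op y) g v.
  by move=> bv; rewrite mul0r addr0 mul1r; exact: (IH _ b10 _ bv bg).
have h0 := conv_op_le_lin z b0 bu cz cp cp cq step.
rewrite !iterS {step}; move: t01 h h0 hp hq => /andP[t0 t1].
generalize (conv_op x (iter n (conv_op x) g) u) (conv_op x (iter n (conv_op y) g) u)
  (conv_op y (iter n (conv_op x) g) u) (conv_op y (iter n (conv_op y) g) u)
  (conv_op z (iter n (conv_op x) g) u)
  (conv_op z (iter n (conv_op y) g) u)
  (conv_op z (iter n (conv_op z) g) u).
move=> xp xq yp yq zp zq zz h h0 hp hq.
have t1' : 0 <= 1 - t by rewrite subr_ge0.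
(* The multipliers 1-t, t and t(1-t) are supplied by hand; what remains is linear in the resulting
   products. *)
have k1 := ler_wpM2l t1' hp; have k2 := ler_wpM2l t0 hq.
have k3 := ler_wpM2l (mulr_ge0 t0 t1') h.
lra.
Qed.
End markov.

(** * Passage from the powers of M_x to C_n *)

Theorem theorem5p4 (R : realType) (X : tvsType R) (K : set X)
  (T : (X -> R) -> (X -> R))
  (mu : X -> probability (@borel R X) R)
  (a : R) (mun : nat -> probability (@borel R X) R) :
  hausdorff_space X ->
  convex_subset K -> compact K ->
  markov_operator K T ->
  (forall h, CK K h -> affine_on K h -> {in K, T h =1 h}) ->
  (* (mu_x)_{x in K}: Borel probability measures on K representing T *)
  (forall x, K x -> mu x K = 1%E) ->
  (forall x f, K x -> CK K f ->
     (\int[mu x]_(t in K) (f t)%:E)%E = (T f x)%:E) ->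
  0 <= a ->
  (* (mu_n)_{n>=1}: Borel probability measures on K *)
  (forall n, (1 <= n)%N -> mun n K = 1%E) ->
  (* (c1) *)
  (forall f, CK K f -> convex_on K f -> convex_on K (T f)) ->
  (* (c2) *)
  (forall f, CK K f -> convex_on K f ->
     forall x y, K x -> K y -> 0 <= Delta K mu f x y) ->
  forall n, (1 <= n)%N ->
  forall f, CK K f -> convex_on K f ->
    CK K (C_op K mu mun a n f) /\ convex_on K (C_op K mu mun a n f).

Proof.
move=> hX convK cK [_ T_CK _ _ _] _ mu1 mu_T a0 mun1 c1 c2 n n1 f /cont_onP cf vf.
have N0 : 0 < n%:R + a by rewrite ltr_wpDr// ltr0n.
(* Absorbing the normalization into [g] moves its domain to (a + n)K: a summand a z in aK, followed
   by n shifts from K. *)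
pose g v := f ((n%:R + a)^-1 *: v).
have DK v : dilate K (a + n%:R) v -> K ((n%:R + a)^-1 *: v).
  by move=> [k Kk <-]; rewrite (addrC a) scalerA mulVf ?scale1r// gt_eqF.
have g_cvx : cvx_cont K (a + n%:R) g.
  split.
    apply: (cont_on_comp (phi := fun v => (n%:R + a)^-1 *: v) _ DK cf).
    exact: dilation_continuous.
  move=> u v t /DK Ku /DK Kv t01; rewrite /g scalerDr !scalerA.
  by rewrite ![_^-1 * _]mulrC -!scalerA; exact: vf.
have C_opE : C_op K mu mun a n f =
    fun x => Rintegral (mun n) K (fun z => iter n (conv_op K mu x) g (a *: z)).
  apply/funext => x; congr Rintegral; apply/funext => z.
  rewrite -iter_conv_op; congr iter_Rint; apply/funext => s.
  by rewrite /g (addrC (a *: z)).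
have Da z : K z -> dilate K a (a *: z) by move=> Kz; exists z.
(* Joint continuity in (x, z) serves twice: integrating in z gives continuity of C_n f, and its
   sections are the integrands compared for convexity. *)
have cH : cont_on (K `*` K) (fun q => iter n (conv_op K mu q.1) g (a *: q.2)).
  apply: (cont_on_comp (phi := fun q : X * X => (q.1, a *: q.2)) _ _
    (iter_conv_op_cont2 hX cK convK mu1 T_CK mu_T a0 g_cvx.1)) => [|[x z] [/= Kx Kz]].
    apply: continuous_pair => q; first exact: cvg_fst.
    apply: (cvg_comp _ _ (@cvg_snd _ _ _ _ _)); exact: dilation_continuous.
  by split=> //; exact: Da.
rewrite C_opE; split.
  apply/cont_onP.
  exact: (cont_on_Rintegral_param hX cK (mun1 n n1) cH).
move=> x y t Kx Ky t01; have Kw := convK _ _ _ Kx Ky t01.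
apply: (Rintegral_le_comb hX cK); [exact: cont_on_section cH Kx|
  exact: cont_on_section cH Ky|exact: cont_on_section cH Kw|].
move=> z Kz.
exact: (iter_conv_op_convex_measure hX cK convK mu1 T_CK mu_T c1 c2 a0 (Da _ Kz)).
Qed.
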